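(* Let $D$ be a diagram with $N$ crossings of an oriented knot $K\subset S^3$. Fix two sign-types $\epsilon_+,\epsilon_-\in\{\pm1\}^N$ whose total-signs (products of all entries) are $+1$ and $-1$ respectively, and let $\mathcal Q_\epsilon:=\mathcal Q_{\epsilon_+}\sqcup\mathcal Q_{\epsilon_-}$. Let $\overline{\mathcal Q}_\epsilon$ be the quotient of $\mathcal Q_\epsilon$ by the equivalence relation $a\sim a'$ iff $Ba=a'$ for some $B\in SL_2(\mathbb C)$ (acting on all coloring vectors simultaneously). Then the map $\overline{\mathcal M}_\epsilon:\overline{\mathcal Q}_\epsilon\to X_{par}$ induced by $a\mapsto\rho_a$ is well-defined and bijective.
   Context: Diagram conventions: $G_K=\pi_1(S^3\setminus K)$; $D$ is an oriented diagram of $K$ with crossings $c_1,\dots,c_N$ and arcs $\mathsf a_1,\dots,\mathsf a_N$ (an arc is a connected piece of $D$ between two consecutive under-crossings). The Wirtinger generator of $\mathsf a_i$ is $m_i$. At a crossing with incoming under-arc $\mathsf a_i$, outgoing under-arc $\mathsf a_j$, over-arc $\mathsf a_k$, the Wirtinger relation is $m_j=m_k^{-1}m_im_k$ (positive crossing) or $m_j=m_km_im_k^{-1}$ (negative crossing). A parabolic representation is a non-abelian homomorphism $\rho:G_K\to SL_2(\mathbb C)$ with $\mathrm{tr}\,\rho(m)=2$, $\rho(m)\neq I$ for every meridian $m$. $X_{par}$ is the set of parabolic representations up to conjugation by $SL_2(\mathbb C)$ (equivalently, the set of their characters, since non-abelian parabolic representations are irreducible). For $b=\binom xy\in\mathbb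 C^2$ let $\mathcal M(b)=\begin{pmatrix}1-xy&x^2\\-y^2&1+xy\end{pmatrix}$; put $a\triangleright b=\mathcal M(b)^{-1}a$, $a\triangleleft b=\mathcal M(b)a$. An arc-coloring of sign-type $\epsilon\in\{\pm1\}^N$ is $a=(a_1,\dots,a_N)\in(\mathbb C^2)^N$ such that at each crossing $c_n$ (with incoming under-arc $\mathsf a_i$, outgoing under-arc $\mathsf a_j$ and over-arc $\mathsf a_k$) $\epsilon_na_j=a_i\triangleright a_k$ if $c_n$ is positive and $\epsilon_na_j=a_i\triangleleft a_k$ if negative. Its associated representation $\rho_a$ is given by $\rho_a(m_i)=\mathcal M(a_i)$. For a sign-type $\epsilon$, $\mathcal Q_\epsilon$ denotes the set of arc-colorings of sign-type $\epsilon$ whose associated representation is a (non-abelian) parabolic representation. *)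

(* Defs.v *)
From HB Require Import structures.
From mathcomp Require Import all_boot all_order all_algebra all_fingroup.
From mathcomp Require Import generic_quotient complex ring.
From mathcomp Require Import all_classical all_reals.

Set Implicit Arguments.
Unset Strict Implicit.
Unset Printing Implicit Defensive.

Import GRing.Theory.

Local Open Scope classical_set_scope.
Local Open Scope quotient_scope.
Local Open Scope ring_scope.

(* The letter (x, true) stands for the generator x, (x, false) for x^-1. *)
Definition word (X : Type) : Type := seq (X * bool).

Inductive pres_eq (X : Type) (r : word X -> word X -> Prop) :
    word X -> word X -> Prop :=
| pres_refl u : pres_eq r u u
| pres_sym u v : pres_eq r u v -> pres_eq r v u
| pres_trans u v w : pres_eq r u v -> pres_eq r v w -> pres_eq r u w
| pres_cancel p x b q : pres_eq r (p ++ [:: (x, b); (x, ~~ b)] ++ q) (p ++ q)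
| pres_rel p u v q : r u v -> pres_eq r (p ++ u ++ q) (p ++ v ++ q).

Section PresentedGroup.
Variables (X : choiceType) (r : word X -> word X -> Prop).

Let W : choiceType := seq (X * bool).
Let winv (u : W) : W := rev [seq (l.1, ~~ l.2) | l <- u].

Definition pres_eqb (u v : W) : bool := `[< pres_eq r u v >].

Lemma pres_eqb_refl : reflexive pres_eqb.
Proof. by move=> u; apply/asboolP; exact: pres_refl. Qed.

Lemma pres_eqb_sym : symmetric pres_eqb.
Proof.
by move=> u v; apply/idP/idP => /asboolP h; apply/asboolP; exact: pres_sym.
Qed.

Lemma pres_eqb_trans : transitive pres_eqb.
Proof.
move=> v u w /asboolP h1 /asboolP h2; apply/asboolP; exact: pres_trans h1 h2.
Qed.

Canonical pres_equiv := EquivRel pres_eqb pres_eqb_refl pres_eqb_sym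
  pres_eqb_trans.

(* The group < X | u = v for all u, v with r u v >. *)
Definition pres_group : Type := {eq_quot pres_equiv}.
HB.instance Definition _ := Choice.on pres_group.
HB.instance Definition _ := EqQuotient.on pres_group.

Lemma pres_groupP (u v : W) :
  \pi_pres_group u = \pi_pres_group v <-> pres_eq r u v.
Proof.
split; first by move/eqmodP => /asboolP.
by move=> h; apply/eqmodP; apply/asboolP.
Qed.

Lemma pres_cat (u u' v v' : W) :
  pres_eq r u u' -> pres_eq r v v' -> pres_eq r (u ++ v) (u' ++ v').
Proof.
move=> hu hv; apply: (@pres_trans _ _ _ (u' ++ v)).
  move: v {v' hv}; elim: hu.
  - by move=> a v; exact: pres_refl.
  - by move=> a b _ IH w; apply/pres_sym/IH.
  - by move=> a b c _ IH1 _ IH2 z; exact: pres_trans (IH1 z) (IH2 z).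
  - by move=> p x b q v; rewrite -!catA; exact: pres_cancel.
  - by move=> p a b q h w; rewrite -!catA; exact: pres_rel.
move: u' {u hu} => w; elim: hv.
- by move=> a; exact: pres_refl.
- by move=> a b _ IH; apply/pres_sym/IH.
- by move=> a b c _ IH1 _ IH2; exact: pres_trans IH1 IH2.
- by move=> p x b q; rewrite !(catA w); exact: pres_cancel.
- by move=> p a b q h; rewrite !(catA w); exact: pres_rel.
Qed.

Let winv_cat u v : winv (u ++ v) = winv v ++ winv u.
Proof. by rewrite /winv map_cat rev_cat. Qed.

Let winv_invol u : winv (winv u) = u.
Proof.
rewrite /winv map_rev revK -map_comp -[RHS]map_id.
by apply: eq_map => -[x b] /=; rewrite negbK.
Qed.

Let pres_mulV u : pres_eq r (u ++ winv u) [::].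
Proof.
elim: u => [|[x b] u IH]; first exact: pres_refl.
rewrite -cat1s winv_cat -catA (catA u).
apply: (@pres_trans _ _ _ ([:: (x, b)] ++ [::] ++ winv [:: (x, b)])).
  by apply/pres_cat; [exact: pres_refl | apply/pres_cat => //; exact: pres_refl].
by have := pres_cancel r [::] x b [::].
Qed.

Let pres_Vmul u : pres_eq r (winv u ++ u) [::].
Proof. by have := pres_mulV (winv u); rewrite winv_invol. Qed.

Let pres_inv u v : pres_eq r u v -> pres_eq r (winv u) (winv v).
Proof.
move=> h; apply: (@pres_trans _ _ _ (winv u ++ v ++ winv v)).
  rewrite -{1}[winv u]cats0; apply/pres_cat; first exact: pres_refl.
  exact/pres_sym/pres_mulV.
rewrite catA -[X in pres_eq r _ X]cat0s; apply/pres_cat; last exact: pres_refl.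
apply: pres_trans (pres_Vmul u); apply/pres_cat; first exact: pres_refl.
exact: pres_sym.
Qed.

Definition pres_mul (g h : pres_group) : pres_group :=
  \pi_pres_group (repr g ++ repr h).
Definition pres_inv_op (g : pres_group) : pres_group :=
  \pi_pres_group (winv (repr g)).
Definition pres_one : pres_group := \pi_pres_group ([::] : W).

Let repr_pi (u : W) : pres_eq r (repr (\pi_pres_group u)) u.
Proof. by apply/pres_groupP; rewrite reprK. Qed.

Let mulE u v :
  pres_mul (\pi_pres_group u) (\pi_pres_group v) = \pi_pres_group (u ++ v).
Proof. by apply/pres_groupP/pres_cat. Qed.

Let invE u : pres_inv_op (\pi_pres_group u) = \pi_pres_group (winv u).
Proof. by apply/pres_groupP/pres_inv. Qed.

Let piW (P : pres_group -> Prop) :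
  (forall u, P (\pi_pres_group u)) -> forall g, P g.
Proof. by move=> h g; rewrite -[g]reprK. Qed.

Let mulA : associative pres_mul.
Proof.
by elim/piW => u; elim/piW => v; elim/piW => w; rewrite !mulE catA.
Qed.

Let mul1 : left_id pres_one pres_mul.
Proof. by elim/piW => u; rewrite mulE. Qed.

Let mulr1 : right_id pres_one pres_mul.
Proof. by elim/piW => u; rewrite mulE cats0. Qed.

Let mulV : left_inverse pres_one pres_inv_op pres_mul.
Proof. by elim/piW => u; rewrite invE mulE; apply/pres_groupP. Qed.

Let mulrV : right_inverse pres_one pres_inv_op pres_mul.
Proof. by elim/piW => u; rewrite invE mulE; apply/pres_groupP. Qed.

HB.instance Definition _ := isGroup.Build pres_group
  mulA mul1 mulr1 mulV mulrV.

Definition pres_gen (x : X) : pres_group := \pi_pres_group ([:: (x, true)] : W).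

End PresentedGroup.

(* The knot runs through every crossing n twice, once along the over-strand
   (n, true) and once along the under-strand (n, false). *)
Definition passage (N : nat) : finType := ('I_N * bool)%type.

(* Half-edges at the crossings: (p, true) leaves the crossing at the end of
   passage p, (p, false) arrives there. *)
Definition half_edge (N : nat) : finType := (passage N * bool)%type.

Definition opposite_half_edge (N : nat) (next : {perm passage N})
    (h : half_edge N) : half_edge N :=
  if h.2 then (next h.1, false) else ((next^-1)%g h.1, true).

(* Next half-edge counterclockwise around the crossing.  The cyclic order is
   over-out, under-out, over-in, under-in at a positive crossing and
   over-out, under-in, over-in, under-out at a negative one. *)
Definition ccw_half_edge (N : nat) (positive : 'I_N -> bool)
    (h : half_edge N) : half_edge N :=
  let: (n, is_over, outgoing) := h in
  (n, ~~ is_over, outgoing (+) (is_over (+) positive n)).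

(* The orbits of this map are the boundary walks of the faces. *)
Definition face_map (N : nat) (next : {perm passage N})
    (positive : 'I_N -> bool) (h : half_edge N) : half_edge N :=
  ccw_half_edge positive (opposite_half_edge next h).

(* Oriented knot diagrams with N crossings, up to isotopy of the sphere.  The
   edge of the diagram leaving passage p is labelled by p; it ends at passage
   next p.  The diagram has N vertices and 2N edges and is connected, so by
   Euler's formula it lies on a sphere iff it has N + 2 faces.
   The map edge_arc sends an edge to the index of the arc containing it: it is
   constant across over-passages and the N edges leaving an under-crossing
   belong to different arcs, so that it is an enumeration of the N arcs. *)
Record knot_diagram (N : nat) : Type := KnotDiagram {
  next : {perm passage N};
  positive : 'I_N -> bool;
  edge_arc : passage N -> 'I_N;
  next_one_component : forall p q : passage N, fconnect next p q;
  face_map_planar : fcard (face_map next positive) predT = N.+2;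
  edge_arc_over : forall p, (next p).2 -> edge_arc (next p) = edge_arc p;
  edge_arc_under : injective (fun n : 'I_N => edge_arc (n, false))
}.

Section KnotGroup.
Variables (N : nat) (D : knot_diagram N).

Definition over_arc (n : 'I_N) : 'I_N := edge_arc D (n, true).
Definition out_arc (n : 'I_N) : 'I_N := edge_arc D (n, false).
Definition in_arc (n : 'I_N) : 'I_N :=
  edge_arc D (((next D)^-1)%g (n, false)).

Inductive wirtinger_rel : word 'I_N -> word 'I_N -> Prop :=
| wirtinger_pos n : positive D n ->
    wirtinger_rel [:: (out_arc n, true)]
      [:: (over_arc n, false); (in_arc n, true); (over_arc n, true)]
| wirtinger_neg n : ~~ positive D n ->
    wirtinger_rel [:: (out_arc n, true)]
      [:: (over_arc n, true); (in_arc n, true); (over_arc n, false)].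

(* The group of the knot, given by its Wirtinger presentation. *)
Definition knot_group : groupType := pres_group wirtinger_rel.

Definition wirtinger_gen (i : 'I_N) : knot_group := pres_gen wirtinger_rel i.

Definition meridian (m : knot_group) : Prop :=
  exists (i : 'I_N) (g : knot_group), m = (wirtinger_gen i ^ g)%g.

End KnotGroup.

(* The quotient of the set Q by the equivalence relation E, as the set of
   equivalence classes. *)
Definition class_in (T : Type) (Q : set T) (E : T -> T -> Prop) (x : T) :
  set T := [set y | Q y /\ E x y].
Definition quotient_set (T : Type) (Q : set T) (E : T -> T -> Prop) :
  set (set T) := [set class_in Q E x | x in Q].

Section ParabolicRepresentations.
Variables (R : realType) (N : nat) (D : knot_diagram N).
Local Notation C := (complex R).
Local Notation rep := (knot_group D -> 'M[C]_2).

Definition SL2_rep (rho : rep) : Prop :=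
  [/\ rho 1%g = 1%:M,
      forall g h, rho (g * h)%g = rho g *m rho h &
      forall g, \det (rho g) = 1].

Definition nonabelian (rho : rep) : Prop :=
  exists g h, rho g *m rho h <> rho h *m rho g.

Definition parabolic (rho : rep) : Prop :=
  [/\ SL2_rep rho, nonabelian rho &
      forall m, meridian m -> \tr (rho m) = 2 /\ rho m <> 1%:M].

Definition conjugate_rep (rho rho' : rep) : Prop :=
  exists B : 'M[C]_2,
    \det B = 1 /\ forall g, rho' g = B *m rho g *m invmx B.

Definition rep_class : rep -> set rep := class_in parabolic conjugate_rep.

Definition Xpar : set (set rep) := quotient_set parabolic conjugate_rep.

End ParabolicRepresentations.

Section ArcColorings.
Variables (R : realType) (N : nat) (D : knot_diagram N).
Local Notation C := (complex R).
Local Notation coloring := {ffun 'I_N -> 'cV[C]_2}.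

Definition par_mx (b : 'cV[C]_2) : 'M[C]_2 :=
  let x := b 0 0 in let y := b 1 0 in
  \matrix_(i, j)
    if i == 0 then (if j == 0 then 1 - x * y else x ^+ 2)
    else (if j == 0 then - y ^+ 2 else 1 + x * y).

Definition quandle_r (a b : 'cV[C]_2) : 'cV[C]_2 := invmx (par_mx b) *m a.
Definition quandle_l (a b : 'cV[C]_2) : 'cV[C]_2 := par_mx b *m a.

Definition sign_type (eps : 'I_N -> int) : Prop :=
  forall n, eps n = 1 \/ eps n = -1.

Definition total_sign (eps : 'I_N -> int) : int := \prod_n eps n.

Definition arc_coloring (eps : 'I_N -> int) (a : coloring) : Prop :=
  forall n, (eps n)%:~R *: a (out_arc D n) =
    if positive D n then quandle_r (a (in_arc D n)) (a (over_arc D n))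
    else quandle_l (a (in_arc D n)) (a (over_arc D n)).

Definition word_eval (f : 'I_N -> 'M[C]_2) (w : word 'I_N) : 'M[C]_2 :=
  foldr (fun l A => (if l.2 then f l.1 else invmx (f l.1)) *m A) 1%:M w.

(* Meaningful when a is an arc-coloring: see assoc_repP. *)
Definition assoc_rep (a : coloring) (g : knot_group D) : 'M[C]_2 :=
  word_eval (fun i => par_mx (a i)) (repr g).

Let ord2P (i : 'I_2) : i = 0 \/ i = 1.
Proof. by case: i => [[|[|//]] ?]; [left | right]; exact: val_inj. Qed.

Let det2 (A : 'M[C]_2) : \det A = A 0 0 * A 1 1 - A 0 1 * A 1 0.
Proof.
rewrite (expand_det_row _ 0) !big_ord_recl big_ord0 /cofactor !det_mx11 !mxE /=.
have -> : lift 0 0 = 1 :> 'I_2 by exact: val_inj.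
have -> : lift 1 0 = 0 :> 'I_2 by exact: val_inj.
by rewrite /= expr0 expr1; ring.
Qed.

Let mul2 (A B : 'M[C]_2) i j : (A *m B) i j = A i 0 * B 0 j + A i 1 * B 1 j.
Proof.
rewrite !mxE !big_ord_recl big_ord0 addr0.
by have -> : lift 0 0 = 1 :> 'I_2 by exact: val_inj.
Qed.

Let mulv2 (A : 'M[C]_2) (b : 'cV[C]_2) i j :
  (A *m b) i j = A i 0 * b 0 j + A i 1 * b 1 j.
Proof.
rewrite !mxE !big_ord_recl big_ord0 addr0.
by have -> : lift 0 0 = 1 :> 'I_2 by exact: val_inj.
Qed.

Lemma det_par_mx b : \det (par_mx b) = 1.
Proof. by rewrite det2 !mxE /=; ring. Qed.

Lemma par_mx_unit b : par_mx b \in unitmx.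
Proof. by rewrite unitmxE det_par_mx unitr1. Qed.

Lemma par_mxZ (e : int) b : e = 1 \/ e = -1 -> par_mx (e%:~R *: b) = par_mx b.
Proof.
by move=> he; apply/matrixP => i j; rewrite !mxE; case: he => ->;
  case: ifP => _; case: ifP => _; ring.
Qed.

Lemma par_mx_act (B : 'M[C]_2) b :
  \det B = 1 -> par_mx (B *m b) = B *m par_mx b *m invmx B.
Proof.
move=> dB; have uB : B \in unitmx by rewrite unitmxE dB unitr1.
suff h : par_mx (B *m b) *m B = B *m par_mx b by rewrite -h mulmxK.
move: dB; rewrite det2 => /eqP; rewrite -subr_eq0 => /eqP dB.
have E i j : par_mx b i j = (i == j)%:R +
    b i 0 * (if j == 0 then - b 1 0 else b 0 0).
  by rewrite mxE; case: (ord2P i) => ->; case: (ord2P j) => -> /=; ring.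
have E' i j : par_mx (B *m b) i j = (i == j)%:R +
    (B *m b) i 0 * (if j == 0 then - (B *m b) 1 0 else (B *m b) 0 0).
  by rewrite mxE; case: (ord2P i) => ->; case: (ord2P j) => -> /=; ring.
apply/matrixP => i j; apply/eqP; rewrite -subr_eq0; apply/eqP.
have -> : (par_mx (B *m b) *m B) i j - (B *m par_mx b) i j =
    (B *m b) i 0 * (if j == 0 then - b 1 0 else b 0 0) *
    (B 0 0 * B 1 1 - B 0 1 * B 1 0 - 1).
  rewrite !mul2 !E !E' !mulv2.
  by case: (ord2P i) => ->; case: (ord2P j) => -> /=; ring.
by rewrite dB mulr0.
Qed.

Lemma assoc_repP (eps : 'I_N -> int) (a : coloring) :
  sign_type eps -> arc_coloring eps a ->
  SL2_rep (assoc_rep a) /\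
  forall i, assoc_rep a (wirtinger_gen D i) = par_mx (a i).
Proof.
move=> heps ha; pose f i := par_mx (a i).
have fu i : f i \in unitmx by exact: par_mx_unit.
have ev_cat u v : word_eval f (u ++ v) = word_eval f u *m word_eval f v.
  by elim: u => [|l u IH] /=; rewrite ?mul1mx // IH mulmxA.
have f_out n : f (out_arc D n) = if positive D n
    then invmx (f (over_arc D n)) *m f (in_arc D n) *m f (over_arc D n)
    else f (over_arc D n) *m f (in_arc D n) *m invmx (f (over_arc D n)).
  rewrite {1}/f -(par_mxZ _ (heps n)) ha; case: ifP => _; last first.
    by rewrite par_mx_act ?det_par_mx.
  rewrite par_mx_act ?invmxK //.
  by rewrite det_inv det_par_mx invr1.
have ev_eq u v : pres_eq (@wirtinger_rel N D) u v ->
    word_eval f u = word_eval f v.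
  elim=> {u v} // [u v w _ -> _ -> //|p x b q|p u v q].
    rewrite !ev_cat; congr (_ *m _); case: b => /=;
      by rewrite !mulmx1 ?mulmxV ?mulVmx ?mul1mx.
  move=> h; rewrite !ev_cat; congr (_ *m (_ *m _)).
  case: h => n hn /=; rewrite !mulmx1 f_out.
    by rewrite hn mulmxA.
  by rewrite (negbTE hn) mulmxA.
have ev_pi (u : word 'I_N) : assoc_rep a (\pi_(knot_group D) u) = word_eval f u.
  by apply: ev_eq; apply/pres_groupP; rewrite reprK.
have det_f i : \det (f i) = 1 by exact: det_par_mx.
split; last by move=> i; rewrite ev_pi /= mulmx1.
split.
- by rewrite ev_pi.
- by move=> g h; rewrite ev_pi ev_cat.
move=> g; rewrite /assoc_rep; elim: (repr g) => [|[i b] u IH] /=.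
  by rewrite det1.
by rewrite det_mulmx IH mulr1; case: b; rewrite ?det_inv det_f ?invr1.
Qed.

Definition Qeps (eps : 'I_N -> int) : set coloring :=
  [set a | arc_coloring eps a /\ parabolic (assoc_rep a)].

(* The disjoint union of Qeps epsp and Qeps epsm, tagged by true and false. *)
Definition Qsum (epsp epsm : 'I_N -> int) : set (bool * coloring) :=
  [set (true, a) | a in Qeps epsp] `|` [set (false, a) | a in Qeps epsm].

Definition act_coloring (B : 'M[C]_2) (x : bool * coloring) : bool * coloring :=
  (x.1, [ffun i => B *m x.2 i]).

Definition equiv_coloring (x x' : bool * coloring) : Prop :=
  exists B : 'M[C]_2, \det B = 1 /\ act_coloring B x = x'.

Definition coloring_class (epsp epsm : 'I_N -> int) :
    bool * coloring -> set (bool * coloring) :=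
  class_in (Qsum epsp epsm) equiv_coloring.

Definition Qbar (epsp epsm : 'I_N -> int) : set (set (bool * coloring)) :=
  quotient_set (Qsum epsp epsm) equiv_coloring.

End ArcColorings.

Arguments Xpar : clear implicits.
Arguments rep_class {R N D} _ _.
Arguments assoc_rep {R N} D a g.
Arguments coloring_class {R N} D epsp epsm.
Arguments Qsum {R N} D epsp epsm.
Arguments Qbar {R N} D epsp epsm.

(* Main.v *)
(* The map M is 2-to-1 onto the parabolic matrices other than I, with fibres
   {b, -b}.  Lifting the matrices of the Wirtinger generators to vectors
   arbitrarily gives an arc-coloring of some sign-type, and changing the lifts
   by signs s multiplies the sign of each crossing by s(in) * s(out).  As the
   knot is a single cycle, the sign-types reached in this way are exactly those
   with the same total-sign, and only a constant s leaves the sign-type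
   unchanged; a constant sign is absorbed by -I in SL_2. *)
Require Import Defs.
From mathcomp Require Import all_boot all_order all_algebra all_fingroup.
From mathcomp Require Import generic_quotient complex ring.
From mathcomp Require Import all_classical all_reals.

Set Implicit Arguments.
Unset Strict Implicit.
Unset Printing Implicit Defensive.

Import Order.TTheory GRing.Theory Num.Theory.

Local Open Scope classical_set_scope.
Local Open Scope ring_scope.

(** * Bijections between quotient sets *)

Lemma quotient_set_bij (T U : Type) (Q : set T) (P : set U)
    (E : T -> T -> Prop) (F : U -> U -> Prop) (f : T -> U) :
  (forall x, E x x) -> (forall x y, E x y -> E y x) ->
  (forall x y z, E x y -> E y z -> E x z) ->
  (forall x, F x x) -> (forall x y, F x y -> F y x) ->
  (forall x y z, F x y -> F y z -> F x z) ->
  (forall x, Q x -> P (f x)) ->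
  (forall x y, Q x -> Q y -> E x y <-> F (f x) (f y)) ->
  (forall y, P y -> exists2 x, Q x & F (f x) y) ->
  exists fbar : set T -> set U,
    (forall x, Q x -> fbar (class_in Q E x) = class_in P F (f x)) /\
    set_bij (quotient_set Q E) (quotient_set P F) fbar.
Proof.
move=> Er Es Et Fr Fs Ft fQ fE fsurj.
have class_eq V (A : set V) (G : V -> V -> Prop) x y :
    (forall x y, G x y -> G y x) -> (forall x y z, G x y -> G y z -> G x z) ->
    G x y -> class_in A G x = class_in A G y.
  move=> Gs Gt xy; apply/seteqP; split => z [Az Gz]; split=> //.
    exact: Gt (Gs _ _ xy) Gz.
  exact: Gt xy Gz.
(* Defined by saturation under [F], so that no representative of a class has to be chosen. *)
pose fbar (S : set T) : set U := [set y | P y /\ exists2 x, S x & F (f x) y].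
have fbarE x : Q x -> fbar (class_in Q E x) = class_in P F (f x).
  move=> Qx; apply/seteqP; split => y [Py].
    by case=> z [Qz xz] zy; split=> //; apply: Ft zy; apply/fE.
  by move=> xy; split=> //; exists x.
exists fbar; split=> //; split.
- by move=> _ [x Qx <-]; rewrite fbarE //; exists (f x) => //; exact: fQ.
- move=> _ _ /set_mem[x Qx <-] /set_mem[y Qy <-]; rewrite !fbarE // => e.
  apply: class_eq => //; apply/fE => //.
  have : class_in P F (f y) (f y) by split; [exact: fQ|].
  by rewrite -e => -[].
- move=> _ [y Py <-]; have [x Qx xy] := fsurj y Py.
  exists (class_in Q E x); first by exists x.
  by rewrite fbarE //; exact: class_eq.
Qed.

(** * Signs along a single cycle *)

Section Signs.

Definition is_sign (e : int) : Prop := e = 1 \/ e = -1.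

Lemma is_sign_sqr e : is_sign e -> e * e = 1.
Proof. by case=> ->. Qed.

Lemma is_signM e f : is_sign e -> is_sign f -> is_sign (e * f).
Proof. by case=> ->; case=> ->; [left|right|right|left]. Qed.

Lemma is_sign_prod (I : Type) (r : seq I) (e : I -> int) :
  (forall i, is_sign (e i)) -> is_sign (\prod_(i <- r) e i).
Proof.
by move=> he; elim/big_ind: _ => //; [left | exact: is_signM].
Qed.

Lemma prod_traject (T : finType) (f : T -> T) (w : T -> int) (x : T) (n : nat) :
  \prod_(y <- traject f x n) w y = \prod_(0 <= i < n) w (iter i f x).
Proof.
elim: n => [|n IH]; first by rewrite big_nil big_geq.
by rewrite trajectSr -cats1 big_cat big_seq1 IH big_nat_recr.
Qed.

(** A multiplicative primitive of [w]: partial products from [x0] satisfy the recursion until the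
    cycle closes, and there total product 1 makes them consistent. *)
Lemma cycle_primitive (T : finType) (f : T -> T) (w : T -> int) (x0 : T) :
  injective f -> (forall x, fconnect f x0 x) ->
  (forall x, is_sign (w x)) -> \prod_x w x = 1 ->
  exists s : T -> int,
    (forall x, is_sign (s x)) /\ forall x, s (f x) = s x * w (f x).
Proof.
move=> fI fC wS w1.
(* The factor at [x0] itself is left out, so [S 0 = 1] and a full turn picks up [w x0] last. *)
pose S k := \prod_(0 <= j < k) w (iter j.+1 f x0).
exists (fun x => S (findex f x0 x)); split=> [x|x]; first exact: is_sign_prod.
have ltk := findex_max (fC x); have xE := iter_findex (fC x).
set k := findex f x0 x in ltk xE *.
have fxE : f x = iter k.+1 f x0 by rewrite /= xE.
have SS : S k.+1 = S k * w (f x) by rewrite /S big_nat_recr //= xE.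
rewrite -SS; have [ltk1|] := ltnP k.+1 (fingraph.order f x0).
  by rewrite {1}fxE findex_iter.
(* Here [x] is the last point of the cycle: [f x] is [x0] again, with index 0 instead of [k.+1], and
   the claim is that the product over a full turn is 1. *)
rewrite leq_eqVlt ltnNge ltk orbF => /eqP oE.
have -> : f x = x0 by rewrite fxE -oE iter_order.
rewrite findex0 -oE /S big_geq //= -(prod_traject f (w \o f)).
apply/esym; rewrite -[RHS]w1 [RHS](reindex_inj fI) /=; apply/esym/perm_big.
apply: uniq_perm; [exact: index_enum_uniq|exact: orbit_uniq|].
by move=> y; rewrite mem_index_enum -fconnect_orbit fC.
Qed.

End Signs.

(** * Sign changes on the arcs of a diagram *)

Section Diagram.
Local Notation next := Defs.next.
Variables (N : nat) (D : knot_diagram N).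

(** On a walk along the knot from an under-passage to [p], the last under-passage met starts the arc
    of [p], and [f] does not change after it. Hence a function on edges that is constant across
    over-passages descends to arcs. *)
Lemma edge_arc_surj (T : Type) (f : passage N -> T) (p : passage N) :
  (forall q, (next D q).2 -> f (next D q) = f q) ->
  exists n, out_arc D n = edge_arc D p /\ f (n, false) = f p.
Proof.
move=> fE; rewrite -(iter_findex (next_one_component D (p.1, false) p)).
elim: (findex _ _ _) => [|k [n [IH1 IH2]]]; first by exists p.1.
set q := iter k _ _ in IH1 IH2; rewrite iterS -/q.
case E: (next D q).2; first by exists n; rewrite edge_arc_over // fE.
by exists (next D q).1; rewrite -E /out_arc -E -surjective_pairing.
Qed.

Lemma out_arc_surj i : exists n, out_arc D n = i.
Proof.
by have [g _ gK] := injF_bij (@edge_arc_under N D); exists (g i); exact: gK.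
Qed.

Lemma prod_passage (w : passage N -> int) :
  (forall n, w (n, true) = 1) -> \prod_p w p = \prod_n w (n, false).
Proof.
move=> w1; transitivity (\prod_n \prod_b w (n, b)).
  by rewrite pair_bigA; apply: eq_bigr => -[].
by apply: eq_bigr => n _; rewrite big_bool /= w1 mul1r.
Qed.

(** The condition at each crossing for rescaling by [s] to turn arc-colorings of sign-type [eps]
    into ones of sign-type [eps']. *)
Definition arc_twist (s : 'I_N -> int) (eps eps' : 'I_N -> int) : Prop :=
  forall n, eps' n * s (out_arc D n) = s (in_arc D n) * eps n.

(** The ratio of the total-signs is the product of all s(in) s(out). Taken over all passages this
    product is a square, since [next] permutes the edges, and the over-passages contribute 1 because
    the arc does not change there. *)
Lemma arc_twist_total_sign s eps eps' :
  (forall i, is_sign (s i)) -> sign_type eps -> arc_twist s eps eps' ->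
  total_sign eps' = total_sign eps.
Proof.
move=> hs he tw.
(* [u] is the sign on the edge leaving a passage, [v] the sign on the edge arriving there. *)
pose u p := s (edge_arc D p); pose v p := u (((next D)^-1)%g p).
have uv : \prod_p (u p * v p) = 1.
  rewrite big_split /=.
  have -> : \prod_p v p = \prod_p u p.
    by rewrite [RHS](reindex_inj (@perm_inj _ ((next D)^-1)%g)).
  by apply: is_sign_sqr; apply: is_sign_prod => p; exact: hs.
move: uv; rewrite prod_passage => [uv|n].
  rewrite -[RHS]mul1r -{}[X in X * _]uv -big_split; apply: eq_bigr => n _ /=.
  rewrite -mulrA -[_ * eps n]/(s (in_arc D n) * eps n) -tw mulrCA.
  by rewrite is_sign_sqr ?mulr1 //; exact: hs.
rewrite /v /u -[in X in X * _](permKV (next D) (n, true)).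
rewrite edge_arc_over ?permKV //.
exact: is_sign_sqr.
Qed.

(** At an under-crossing the factor [eps n] cancels from both sides, and at an over-passage the arc
    stays the same. So [s] agrees on consecutive edges, and these form one cycle. *)
Lemma arc_twist_const s eps :
  sign_type eps -> arc_twist s eps eps -> forall i j, s i = s j.
Proof.
move=> he tw; pose u p := s (edge_arc D p).
have step p : u (next D p) = u p.
  rewrite /u; case E: (next D p).2; first by rewrite edge_arc_over.
  have nE : next D p = ((next D p).1, false) by rewrite -E -surjective_pairing.
  have := tw (next D p).1; rewrite mulrC /out_arc /in_arc -nE permK.
  move/(congr1 ( *%R^~ (eps (next D p).1))).
  by rewrite -!mulrA is_sign_sqr // !mulr1.
have const p q : u q = u p.
  rewrite -(iter_findex (next_one_component D p q)).
  by elim: (findex _ _ _) => //= k <-.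
move=> i j; have [n <-] := out_arc_surj i; have [m <-] := out_arc_surj j.
exact: const.
Qed.

Lemma arc_twist_exists eps eps' :
  sign_type eps -> sign_type eps' -> total_sign eps = total_sign eps' ->
  exists2 s : 'I_N -> int, forall i, is_sign (s i) & arc_twist s eps eps'.
Proof.
move=> he he' te.
(* A crossing is needed as the base point of the cycle; without crossings the condition is empty. *)
have [n0|nN] := pselect (exists n : 'I_N, True); last first.
  by exists (fun=> 1) => [i|n]; [left|case: nN; exists n].
case: n0 => n0 _.
(* The sign by which [s] must change on traversing [p]. *)
pose w (p : passage N) := if p.2 then 1 else eps p.1 * eps' p.1.
have wS p : is_sign (w p).
  by rewrite /w; case: ifP => _; [left|exact: is_signM].
have w1 : \prod_p w p = 1.
  rewrite prod_passage // /w /= big_split.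
  rewrite -/(total_sign eps) -/(total_sign eps').
  by rewrite te; apply: is_sign_sqr; apply: is_sign_prod; exact: he'.
have [S [SS SE]] := cycle_primitive (@perm_inj _ (next D))
  (next_one_component D (n0, true)) wS w1.
have Sover q : (next D q).2 -> S (next D q) = S q.
  by rewrite SE /w => ->; rewrite mulr1.
have [g gK Kg] := injF_bij (@edge_arc_under N D).
(* [g i] is the crossing where arc [i] begins, so the value is read on the first edge of the arc;
   [arcS] shows that any other edge of the arc gives the same. *)
exists (fun i => S (g i, false)) => [//|n].
have arcS p : S (g (edge_arc D p), false) = S p.
  by have [m [<- <-]] := edge_arc_surj p Sover; rewrite /out_arc gK.
rewrite /out_arc /in_arc !arcS.
rewrite -{1}[(n, false)](permKV (next D)) SE permKV /w /=.
by rewrite mulrCA [X in _ * X]mulrCA (is_sign_sqr (he' n)) mulr1.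
Qed.

End Diagram.

(** * Parabolic matrices and their vectors *)

Section Matrices.
Variable R : realType.
Local Notation C := (complex R).

Lemma ord2P (i : 'I_2) : i = 0 \/ i = 1.
Proof. by case: i => [[|[|//]] ?]; [left | right]; exact: val_inj. Qed.

Lemma det_mx22 (A : 'M[C]_2) : \det A = A 0 0 * A 1 1 - A 0 1 * A 1 0.
Proof.
rewrite (expand_det_row _ 0) !big_ord_recl big_ord0 /cofactor !det_mx11 !mxE /=.
have -> : lift 0 0 = 1 :> 'I_2 by exact: val_inj.
have -> : lift 1 0 = 0 :> 'I_2 by exact: val_inj.
by rewrite /= expr0 expr1; ring.
Qed.

Lemma mxtrace22 (A : 'M[C]_2) : \tr A = A 0 0 + A 1 1.
Proof.
rewrite /mxtrace !big_ord_recl big_ord0 addr0.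
by have -> : lift 0 0 = 1 :> 'I_2 by exact: val_inj.
Qed.

Lemma det1_unit (B : 'M[C]_2) : \det B = 1 -> B \in unitmx.
Proof. by rewrite unitmxE => ->; rewrite unitr1. Qed.

Lemma conj_mxP (X Y B : 'M[C]_2) : B \in unitmx ->
  X = B *m Y *m invmx B <-> X *m B = B *m Y.
Proof. by move=> uB; split=> [->|<-]; rewrite ?mulmxKV ?mulmxK. Qed.

Lemma det_sign_mx (e : int) : is_sign e -> \det (e%:~R *: 1%:M : 'M[C]_2) = 1.
Proof.
by rewrite detZ det1 mulr1; case=> ->; rewrite ?expr1n // sqrrN expr1n.
Qed.

Lemma par_mx0 : par_mx (0 : 'cV[C]_2) = 1%:M.
Proof.
apply/matrixP => i j; rewrite !mxE.
by case: (ord2P i) => ->; case: (ord2P j) => -> /=;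
  rewrite ?mulr0 ?expr0n ?subr0 ?addr0 ?oppr0.
Qed.

(** The equations are x^2 = A01, xy = 1 - A00 and y^2 = -A10. Trace 2 and determinant 1 give (1 -
    A00)^2 = -A01 A10, which makes them compatible. *)
Lemma par_mx_surj (A : 'M[C]_2) :
  \det A = 1 -> \tr A = 2 -> exists b, par_mx b = A.
Proof.
rewrite det_mx22 mxtrace22 => dA tA.
have A11 : A 1 1 = 2 - A 0 0 by rewrite -tA; ring.
pose p := 1 - A 0 0; pose x := sqrtC (A 0 1).
have xE : x ^+ 2 = A 0 1 by exact: sqrtCK.
have pE : p ^+ 2 = - (A 0 1 * A 1 0).
  have : p ^+ 2 + A 0 1 * A 1 0 = 1 - (A 0 0 * A 1 1 - A 0 1 * A 1 0).
    by rewrite A11 /p; ring.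
  by rewrite dA subrr => /eqP; rewrite addr_eq0 => /eqP.
(* For nonzero [x] the product forces [y]; for [x = 0] also [p = 0], and only the equation for y^2
   remains. *)
pose y := if x == 0 then sqrtC (- A 1 0) else p / x.
have [xy yE] : x * y = p /\ y ^+ 2 = - A 1 0.
  rewrite /y; case: eqP => [x0|/eqP x0].
    split; last exact: sqrtCK.
    apply/esym/eqP; rewrite x0 mul0r -sqrf_eq0 pE -xE x0.
    by rewrite expr0n mul0r oppr0.
  split; first by rewrite mulrC divfK.
  rewrite expr_div_n pE -xE mulNr mulrAC divff ?mul1r //.
  by rewrite sqrf_eq0.
exists (\col_i if i == 0 then x else y).
apply/matrixP => i j; rewrite !mxE.
case: (ord2P i) => ->; case: (ord2P j) => -> /=;
  by rewrite ?xy ?xE ?yE ?A11 /p; ring.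
Qed.

(** The entries determine x^2, xy and y^2. The sign is read off the first coordinate if it is
    nonzero, and xy transfers it to the second; otherwise it is read off the second. *)
Lemma par_mx_inj_sign (a b : 'cV[C]_2) :
  par_mx a = par_mx b -> exists2 e : int, is_sign e & a = e%:~R *: b.
Proof.
move=> ab; have E i j : par_mx a i j = par_mx b i j by rewrite ab.
move: (E 0 0) (E 0 1) (E 1 0); rewrite !mxE /=.
move=> /addrI/oppr_inj xy x2 /oppr_inj y2.
have colP (u v : 'cV[C]_2) : u 0 0 = v 0 0 -> u 1 0 = v 1 0 -> u = v.
  by move=> h0 h1; apply/colP => i; case: (ord2P i) => ->.
have [b0|b0] := eqVneq (b 0 0) 0.
  have a0 : a 0 0 = 0 by apply/eqP; rewrite -sqrf_eq0 x2 b0 expr0n.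
  move/eqP: y2; rewrite eqf_sqr => /orP[] /eqP y2.
    by exists 1; [left|apply: colP; rewrite !mxE mul1r // a0 b0].
  by exists (-1); [right|apply: colP; rewrite !mxE mulN1r // a0 b0 oppr0].
move/eqP: x2; rewrite eqf_sqr => /orP[] /eqP x2; rewrite x2 in xy.
  exists 1; first by left.
  by apply: colP; rewrite !mxE mul1r //; exact: (mulfI b0).
exists (-1); first by right.
apply: colP; rewrite !mxE mulN1r //; apply: (mulfI b0).
by rewrite mulrN -xy mulNr opprK.
Qed.

End Matrices.

(** * Representations of the Wirtinger presentation *)

Section Representations.
Local Open Scope quotient_scope.
Variables (R : realType) (N : nat) (D : knot_diagram N).
Local Notation C := (complex R).
Local Notation rep := (knot_group D -> 'M[C]_2).
Local Notation coloring := {ffun 'I_N -> 'cV[C]_2}.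

Lemma pres_pi_cat (X : choiceType) (r : word X -> word X -> Prop)
    (u v : seq (X * bool)) :
  (\pi_(pres_group r) (u ++ v) =
    \pi_(pres_group r) u * \pi_(pres_group r) v :> pres_group r)%g.
Proof.
by apply/pres_groupP/pres_cat; apply/pres_groupP; rewrite reprK.
Qed.

Lemma pres_pi_letter (X : choiceType) (r : word X -> word X -> Prop) (x : X)
    (b : bool) :
  (\pi_(pres_group r) [:: (x, b)] =
    if b then pres_gen r x else (pres_gen r x)^-1 :> pres_group r)%g.
Proof.
case: b => //; apply: (@mulgI (pres_group r) (pres_gen r x)).
rewrite mulgV -pres_pi_cat.
by apply/pres_groupP; have := pres_cancel r [::] x true [::].
Qed.

Lemma SL2_repV (rho : rep) g : SL2_rep rho -> rho (g^-1)%g = invmx (rho g).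
Proof.
move=> [r1 rM rd]; have ug := det1_unit (rd g).
by rewrite -[LHS](mulmxK ug) -rM mulVg r1 mul1mx.
Qed.

Lemma SL2_rep_pi (rho : rep) (u : seq ('I_N * bool)) : SL2_rep rho ->
  rho (\pi_(knot_group D) u) = word_eval (fun i => rho (wirtinger_gen D i)) u.
Proof.
move=> hr; have [r1 rM _] := hr.
elim: u => [|[i b] u IH]; first exact: r1.
rewrite -cat1s pres_pi_cat rM IH pres_pi_letter /=.
by case: b => //; rewrite SL2_repV.
Qed.

Lemma SL2_rep_ext (rho rho' : rep) : SL2_rep rho -> SL2_rep rho' ->
  (forall i, rho (wirtinger_gen D i) = rho' (wirtinger_gen D i)) -> rho = rho'.
Proof.
move=> hr hr' e; apply/funext => g.
by rewrite -[g]reprK !SL2_rep_pi //; congr word_eval; apply/funext.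
Qed.

Lemma SL2_rep_conj (rho : rep) (B : 'M[C]_2) : \det B = 1 -> SL2_rep rho ->
  SL2_rep (fun g => B *m rho g *m invmx B).
Proof.
move=> dB [r1 rM rd]; have uB := det1_unit dB; split.
- by rewrite r1 mulmx1 mulmxV.
- by move=> g h; rewrite rM !mulmxA mulmxKV.
- by move=> g; rewrite !det_mulmx det_inv dB rd invr1 !mulr1.
Qed.

(* The Wirtinger relation at crossing n reads f(out) = A f(in) A^-1 and the
   coloring condition reads eps_n a(out) = A a(in), for this matrix A. *)
Definition crossing_mx (f : 'I_N -> 'M[C]_2) (n : 'I_N) : 'M[C]_2 :=
  if positive D n then invmx (f (over_arc D n)) else f (over_arc D n).

Lemma SL2_rep_crossing (rho : rep) n : SL2_rep rho ->
  let f i := rho (wirtinger_gen D i) in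
  f (out_arc D n) =
    crossing_mx f n *m f (in_arc D n) *m invmx (crossing_mx f n).
Proof.
move=> hr f.
have rel u v : wirtinger_rel D u v -> word_eval f u = word_eval f v.
  move=> uv; rewrite -!SL2_rep_pi //; congr rho; apply/pres_groupP.
  by have := pres_rel [::] [::] uv; rewrite !cats0.
rewrite /crossing_mx; case: ifP => hn; first have := rel _ _ (wirtinger_pos hn).
  by rewrite /= !mulmx1 mulmxA invmxK.
by have := rel _ _ (wirtinger_neg (negbT hn)); rewrite /= !mulmx1 mulmxA.
Qed.

(** * Arc-colorings under [SL_2] and under sign changes *)

Definition color_mx (a : coloring) : 'I_N -> 'M[C]_2 := fun i => par_mx (a i).

Lemma det_crossing_mx (a : coloring) n : \det (crossing_mx (color_mx a) n) = 1.
Proof.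
by rewrite /crossing_mx; case: ifP; rewrite ?det_inv det_par_mx ?invr1.
Qed.

Lemma arc_coloringE (eps : 'I_N -> int) (a : coloring) :
  arc_coloring D eps a <-> forall n, (eps n)%:~R *: a (out_arc D n) =
    crossing_mx (color_mx a) n *m a (in_arc D n).
Proof.
by split=> h n; have := h n; rewrite /crossing_mx /quandle_r /quandle_l;
  case: ifP.
Qed.

(** By [par_mx_act] each crossing matrix A becomes B A B^-1, so the crossing relation is
    equivariant. *)
Lemma arc_coloring_act (eps : 'I_N -> int) (a : coloring) (B : 'M[C]_2) :
  \det B = 1 -> arc_coloring D eps a ->
  arc_coloring D eps [ffun i => B *m a i].
Proof.
move=> dB /arc_coloringE ha; apply/arc_coloringE => n.
have uB := det1_unit dB.
rewrite !ffunE scalemxAr ha /crossing_mx /color_mx ffunE par_mx_act //.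
case: ifP => _; rewrite !mulmxA; last by rewrite mulmxKV.
(* At a positive crossing it remains to see that (B M B^-1)^-1 = B M^-1 B^-1, where M belongs to the
   over-arc. *)
congr (_ *m _); apply/esym; rewrite -conj_mxP //.
have uM : B *m par_mx (a (over_arc D n)) *m invmx B \in unitmx.
  by rewrite -par_mx_act // par_mx_unit.
apply: (can_inj (mulKmx uM)); rewrite mulmxV //.
by rewrite !mulmxA mulmxKV // mulmxK ?par_mx_unit // mulmxV.
Qed.

Lemma crossing_mx_sign (a : coloring) (s : 'I_N -> int) n :
  (forall i, is_sign (s i)) ->
  crossing_mx (color_mx [ffun i => (s i)%:~R *: a i]) n =
  crossing_mx (color_mx a) n.
Proof.
by move=> hs; rewrite /crossing_mx /color_mx ffunE par_mxZ //; exact: hs.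
Qed.

Lemma arc_coloring_twist (eps eps' : 'I_N -> int) (a : coloring)
    (s : 'I_N -> int) :
  (forall i, is_sign (s i)) -> arc_twist D s eps eps' -> arc_coloring D eps a ->
  arc_coloring D eps' [ffun i => (s i)%:~R *: a i].
Proof.
move=> hs tw /arc_coloringE ha; apply/arc_coloringE => n.
rewrite crossing_mx_sign // !ffunE -scalemxAr -ha !scalerA -!intrM.
by rewrite tw.
Qed.

(** Converse of [arc_coloring_twist]: both colorings express the same vector as a multiple of
    [a (out_arc D n)], and the scalars can be compared because this vector is nonzero. *)
Lemma arc_twist_of_coloring (eps eps' : 'I_N -> int) (a : coloring)
    (s : 'I_N -> int) :
  (forall i, is_sign (s i)) -> (forall i, a i != 0) ->
  arc_coloring D eps a -> arc_coloring D eps' [ffun i => (s i)%:~R *: a i] ->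
  arc_twist D s eps eps'.
Proof.
move=> hs a0 /arc_coloringE ha /arc_coloringE ha' n.
have := ha' n; rewrite crossing_mx_sign // !ffunE -scalemxAr -ha !scalerA.
rewrite -!intrM.
move/eqP; rewrite -subr_eq0 -scalerBl scaler_eq0 (negbTE (a0 _)) orbF subr_eq0.
by move/eqP/intr_inj.
Qed.

(** * Passage between colorings and parabolic representations *)

Lemma assoc_rep_act (eps : 'I_N -> int) (a : coloring) (B : 'M[C]_2) :
  sign_type eps -> \det B = 1 -> arc_coloring D eps a ->
  assoc_rep D [ffun i => B *m a i] = fun g => B *m assoc_rep D a g *m invmx B.
Proof.
move=> he dB ha; have [ra rE] := assoc_repP he ha.
have [rBa rBE] := assoc_repP he (arc_coloring_act dB ha).
apply: SL2_rep_ext => // [|i]; first exact: SL2_rep_conj.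
by rewrite rBE rE ffunE par_mx_act.
Qed.

Lemma parabolic_gen (rho : rep) i : parabolic rho ->
  \tr (rho (wirtinger_gen D i)) = 2 /\ rho (wirtinger_gen D i) <> 1%:M.
Proof. by case=> _ _; apply; exists i, 1%g; rewrite conjg1. Qed.

Lemma Qeps_neq0 (eps : 'I_N -> int) (a : coloring) i :
  sign_type eps -> Qeps D eps a -> a i != 0.
Proof.
move=> he [ha pa]; have [_ rE] := assoc_repP he ha.
have [_] := parabolic_gen i pa; rewrite rE => h.
by apply/eqP => a0; apply: h; rewrite a0 par_mx0.
Qed.

Lemma coloring_of_rep (rho : rep) : parabolic rho ->
  exists (eps : 'I_N -> int) (b : coloring),
    [/\ sign_type eps, arc_coloring D eps b &
        forall i, par_mx (b i) = rho (wirtinger_gen D i)].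
Proof.
move=> pr; have [hr _ _] := pr; have [_ _ rd] := hr.
have /choice[b0 b0E] i :
    exists b : 'cV[C]_2, par_mx b = rho (wirtinger_gen D i).
  apply: par_mx_surj => //.
  by have [] := parabolic_gen i pr.
pose b : coloring := finfun b0.
have bE i : par_mx (b i) = rho (wirtinger_gen D i) by rewrite ffunE.
have cE n : crossing_mx (color_mx b) n =
    crossing_mx (fun i => rho (wirtinger_gen D i)) n.
  by rewrite /crossing_mx /color_mx bE.
(* For A = [crossing_mx (color_mx b) n], the vectors A b(in) and b(out) have the same parabolic
   matrix by the Wirtinger relation. They differ by a sign, which is taken as [eps n]. *)
have /choice[eps epsE] n : exists e : int, is_sign e /\
    crossing_mx (color_mx b) n *m b (in_arc D n) = e%:~R *: b (out_arc D n).
  have [|e he eE] := @par_mx_inj_sign R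
      (crossing_mx (color_mx b) n *m b (in_arc D n)) (b (out_arc D n)).
    rewrite par_mx_act ?det_crossing_mx // !bE cE.
    by rewrite -(SL2_rep_crossing n hr).
  by exists e.
exists eps, b; split => //; first by move=> n; have [] := epsE n.
by apply/arc_coloringE => n; have [_ ->] := epsE n.
Qed.

(** Sign changes of the lifts adjust the sign-type and leave each [par_mx (b i)], hence the
    representation, as it was. *)
Lemma Qeps_rep_surj (eps : 'I_N -> int) (b : coloring) (eps' : 'I_N -> int)
    (rho : rep) :
  parabolic rho -> sign_type eps -> sign_type eps' ->
  total_sign eps = total_sign eps' -> arc_coloring D eps b ->
  (forall i, par_mx (b i) = rho (wirtinger_gen D i)) ->
  exists2 a, Qeps D eps' a & assoc_rep D a = rho.
Proof.
move=> pr he he' te hb bE; have [hr _ _] := pr.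
have [s hs tw] := arc_twist_exists D he he' te.
have ha := arc_coloring_twist hs tw hb.
have [ra rE] := assoc_repP he' ha.
have e : assoc_rep D [ffun i => (s i)%:~R *: b i] = rho.
  by apply: SL2_rep_ext => // i; rewrite rE ffunE par_mxZ //; exact: hs.
by eexists; [split; [exact: ha|]|exact: e]; rewrite e.
Qed.

(** On generators, conjugacy by [B] says that a'(i) and B a(i) have the same parabolic matrix, so
    they differ by signs; comparing the two colorings shows that these signs form a twist. *)
Lemma Qeps_conj_inj (eps eps' : 'I_N -> int) (a a' : coloring) :
  sign_type eps -> sign_type eps' -> Qeps D eps a -> Qeps D eps' a' ->
  conjugate_rep (assoc_rep D a) (assoc_rep D a') ->
  exists s : 'I_N -> int, exists B : 'M[C]_2,
    [/\ forall i, is_sign (s i), arc_twist D s eps eps', \det B = 1 &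
        a' = [ffun i => (s i)%:~R *: (B *m a i)]].
Proof.
move=> he he' Qa Qa' [B [dB BE]].
have [[ha _] [ha' _]] := (Qa, Qa').
have uB := det1_unit dB.
have [_ rE] := assoc_repP he ha; have [_ rE'] := assoc_repP he' ha'.
have /choice[s sE] i : exists e : int, is_sign e /\ a' i = e%:~R *: (B *m a i).
  have [|e he0 eE] := @par_mx_inj_sign R (a' i) (B *m a i).
    by rewrite par_mx_act // -rE' BE rE.
  by exists e.
have hs i : is_sign (s i) by have [] := sE i.
have a'E : a' = [ffun i => (s i)%:~R *: (B *m a i)].
  by apply/ffunP => i; rewrite ffunE; have [] := sE i.
exists s, B; split => //.
pose Ba : coloring := [ffun i => B *m a i].
have a'B : a' = [ffun i => (s i)%:~R *: Ba i].
  by rewrite a'E; apply/ffunP => i; rewrite !ffunE.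
apply: (@arc_twist_of_coloring _ _ Ba) => //.
- move=> i; rewrite ffunE; apply: contra (Qeps_neq0 i he Qa) => /eqP h.
  by rewrite -(mulKmx uB (a i)) h mulmx0.
- exact: arc_coloring_act.
- by rewrite -a'B.
Qed.

(** * The two equivalence relations and their comparison *)

Lemma conjugate_rep_refl (rho : rep) : conjugate_rep rho rho.
Proof.
by exists 1%:M; split=> [|g]; rewrite ?det1 // invmx1 mul1mx mulmx1.
Qed.

Lemma conjugate_rep_sym (rho rho' : rep) :
  conjugate_rep rho rho' -> conjugate_rep rho' rho.
Proof.
move=> [B [dB BE]]; have uB := det1_unit dB.
exists (invmx B); split=> [|g]; first by rewrite det_inv dB invr1.
by rewrite BE invmxK !mulmxA mulVmx // mul1mx mulmxKV.
Qed.

Lemma conjugate_rep_trans (rho rho' rho'' : rep) :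
  conjugate_rep rho rho' -> conjugate_rep rho' rho'' -> conjugate_rep rho rho''.
Proof.
move=> [B [dB BE]] [A [dA AE]]; have [uA uB] := (det1_unit dA, det1_unit dB).
have dAB : \det (A *m B) = 1 by rewrite det_mulmx dA dB mulr1.
exists (A *m B); split=> // g; apply/conj_mxP; first exact: det1_unit.
by rewrite AE BE !mulmxA mulmxKV // mulmxKV.
Qed.

Lemma equiv_coloring_refl (x : bool * coloring) : equiv_coloring x x.
Proof.
exists 1%:M; split; first exact: det1.
case: x => t a; congr pair => /=.
by apply/ffunP => i; rewrite ffunE mul1mx.
Qed.

Lemma equiv_coloring_sym (x y : bool * coloring) :
  equiv_coloring x y -> equiv_coloring y x.
Proof.
case: x => t a [B [dB <-]]; exists (invmx B).
split; first by rewrite det_inv dB invr1.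
congr pair => /=; apply/ffunP => i.
by rewrite !ffunE mulKmx ?det1_unit.
Qed.

Lemma equiv_coloring_trans (x y z : bool * coloring) :
  equiv_coloring x y -> equiv_coloring y z -> equiv_coloring x z.
Proof.
case: x => t a [B [dB <-]] [A [dA <-]]; exists (A *m B).
split; first by rewrite det_mulmx dA dB mulr1.
by congr pair => /=; apply/ffunP => i; rewrite !ffunE mulmxA.
Qed.

Lemma QsumE (epsp epsm : 'I_N -> int) (x : bool * coloring) :
  Qsum D epsp epsm x <-> Qeps D (if x.1 then epsp else epsm) x.2.
Proof.
case: x => t a; split=> [[[b Qb [<- <-]]|[b Qb [<- <-]]] //|].
by case: t => /= Qa; [left|right]; exists a.
Qed.

Lemma equiv_coloringP (epsp epsm : 'I_N -> int) (x y : bool * coloring) :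
  sign_type epsp -> sign_type epsm -> total_sign epsp <> total_sign epsm ->
  Qsum D epsp epsm x -> Qsum D epsp epsm y ->
  equiv_coloring x y <-> conjugate_rep (assoc_rep D x.2) (assoc_rep D y.2).
Proof.
move=> hp hm hpm /QsumE Qx /QsumE Qy.
pose e (t : bool) := if t then epsp else epsm.
have he t : sign_type (e t) by case: t.
split=> [[B [dB <-]]|xy].
  exists B; split=> // g; have [cx _] := Qx.
  by rewrite /= (assoc_rep_act (he x.1)).
have [s [B [hs tw dB yE]]] := Qeps_conj_inj (he x.1) (he y.1) Qx Qy xy.
(* A twist preserves the total-sign, which tells the two sign-types apart. *)
have t12 : y.1 = x.1.
  have := arc_twist_total_sign hs (he x.1) tw.
  by case: (x.1) (y.1) => -[] //= /esym/hpm.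
rewrite t12 in tw; have sc := arc_twist_const (he x.1) tw.
(* The constant value of [s] is read at some arc and absorbed into [B] as a factor of plus or minus
   the identity; without arcs there is only one coloring. *)
have [n0|nN] := pselect (exists i : 'I_N, True); last first.
  exists 1%:M; split; first exact: det1.
  case: x y t12 {yE Qx Qy xy tw sc} => [t a] [t' a'] /= ->; congr pair.
  by apply/ffunP => i; case: nN; exists i.
case: n0 => i0 _; exists (((s i0)%:~R *: 1%:M) *m B).
split; first by rewrite det_mulmx dB mulr1 det_sign_mx.
rewrite [RHS]surjective_pairing t12 yE; congr pair.
apply/ffunP => i; rewrite !ffunE -mulmxA -scalemxAl mul1mx.
by rewrite (sc i i0).
Qed.

End Representations.

Theorem theorem3p11 (R : realType) (N : nat) (D : knot_diagram N)
    (epsp epsm : 'I_N -> int)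
    (hepsp : sign_type epsp) (hepsm : sign_type epsm)
    (hplus : total_sign epsp = 1) (hminus : total_sign epsm = -1) :
  exists Mbar : set (bool * {ffun 'I_N -> 'cV[complex R]_2}) ->
                set (knot_group D -> 'M[complex R]_2),
    (forall x, Qsum D epsp epsm x ->
       Mbar (coloring_class D epsp epsm x) = rep_class (assoc_rep D x.2)) /\
    set_bij (Qbar D epsp epsm) (Xpar R N D) Mbar.
Proof.
have neq : total_sign epsp <> total_sign epsm by rewrite hplus hminus.
apply: quotient_set_bij.
- exact: equiv_coloring_refl.
- exact: equiv_coloring_sym.
- exact: equiv_coloring_trans.
- exact: conjugate_rep_refl.
- exact: conjugate_rep_sym.
- exact: conjugate_rep_trans.
- by move=> x /QsumE[].
- by move=> x y Qx Qy; exact: equiv_coloringP neq Qx Qy.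
move=> rho pr; have [eps [b [he hb bE]]] := coloring_of_rep pr.
(* The total-sign of the arbitrary lift selects the component of the disjoint union in which the
   preimage lies. *)
have te : total_sign eps =
    total_sign (if total_sign eps == 1 then epsp else epsm).
  have [->|->] : is_sign (total_sign eps) by exact: is_sign_prod.
    by rewrite eqxx hplus.
  by rewrite hminus.
have [|a Qa <-] := Qeps_rep_surj pr he _ te hb bE; first by case: ifP.
exists (total_sign eps == 1, a); first exact/QsumE.
exact: conjugate_rep_refl.
Qed.
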